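(* Let $M$ be an irredundant matrix and let $n\ge 2$. Then $M$ satisfies a depth $n$ inequality if and only if $Z(M^{n-1}) = Z(M^{n+1})$.
   Context: An $r\times s$ matrix $M=(m_{ij})$ with non-negative integer entries is irredundant if every row and every column of $M$ is nonzero. Powers of $M$ are understood as $M^1=M$, $M^2=MM^t$, $M^3=MM^tM$, $M^4=MM^tMM^t$, etc. Inequalities between matrices are entrywise. $M$ satisfies a depth $n$ inequality if there is a positive integer $q$ with $M^{n+1}\le qM^{n-1}$. For a matrix $X=(x_{ij})$, $Z(X)=\{(i,j)\mid x_{ij}=0\}$ is the set of positions of its zero entries. *)

(* Defs.v *)
From mathcomp Require Import all_boot all_order all_algebra.

Set Implicit Arguments.
Unset Strict Implicit.
Unset Printing Implicit Defensive.

Import GRing.Theory.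
Local Open Scope ring_scope.

Definition irredundant r s (M : 'M[nat]_(r, s)) : Prop :=
  (forall i, row i M != 0) /\ (forall j, col j M != 0).

(* The number of columns of M^n, for M of size r x s: r if n is even, s if n
   is odd.  Two-step recursion makes [altcols r s n.+2] convertible to
   [altcols r s n]. *)
Fixpoint altcols (r s n : nat) : nat :=
  match n with
  | 0 => r
  | 1 => s
  | m.+2 => altcols r s m
  end.

(* The alternating power M^n = M M^t M ... (n factors), with M^0 the identity
   by convention. *)
Fixpoint altpow r s (M : 'M[nat]_(r, s)) (n : nat) :
    'M[nat]_(r, altcols r s n) :=
  match n return 'M[nat]_(r, altcols r s n) with
  | 0 => 1%:M
  | 1 => M
  | m.+2 => M *m M^T *m altpow M m
  end.

Lemma altpow1 r s (M : 'M[nat]_(r, s)) : altpow M 1 = M.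
Proof. by []. Qed.

Lemma altpow2 r s (M : 'M[nat]_(r, s)) : altpow M 2 = M *m M^T.
Proof. by rewrite /= mulmx1. Qed.

Lemma altpow3 r s (M : 'M[nat]_(r, s)) : altpow M 3 = M *m M^T *m M.
Proof. by []. Qed.

Lemma altpow4 r s (M : 'M[nat]_(r, s)) :
  altpow M 4 = M *m M^T *m M *m M^T.
Proof. by rewrite /= mulmx1 !mulmxA. Qed.

Lemma altcols_succ_pred r s n :
  (0 < n)%N -> altcols r s n.+1 = altcols r s n.-1.
Proof. by case: n. Qed.

(* For n > 0, the matrix M^(n+1) typed with the dimensions of M^(n-1), so that
   the two can be compared; the entries are unchanged. *)
Definition altpow_succ r s (M : 'M[nat]_(r, s)) (n : nat) (n_gt0 : (0 < n)%N) :
    'M[nat]_(r, altcols r s n.-1) :=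
  castmx (erefl r, altcols_succ_pred r s n_gt0) (altpow M n.+1).

Definition depth_inequality r s (M : 'M[nat]_(r, s)) (n : nat)
    (n_gt0 : (0 < n)%N) : Prop :=
  exists2 q : nat, (0 < q)%N &
    forall i j, (altpow_succ M n_gt0 i j <= (q *: altpow M n.-1) i j)%N.

Definition zeros m n (X : 'M[nat]_(m, n)) : {set 'I_m * 'I_n} :=
  [set ij | X ij.1 ij.2 == 0].

(* Main.v *)
Require Import Defs.
From mathcomp Require Import all_boot all_order all_algebra.

(* Since every row of M is nonzero, the diagonal of M M^t is positive, so
   M^(n-1) <= M M^t M^(n-1) = M^(n+1) and Z(M^(n+1)) is always contained in
   Z(M^(n-1)).  The reverse inclusion is what a bound M^(n+1) <= q M^(n-1)
   expresses, because the matrices are finite: q can be taken larger than all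
   entries of M^(n+1). *)

Import GRing.Theory.
Local Open Scope ring_scope.

(** At a successor index the two column counts are convertible, so the cast is the identity. *)
Lemma altpow_succE {r s} (M : 'M[nat]_(r, s)) k (k_gt0 : (0 < k.+1)%N) :
  altpow_succ M k_gt0 = M *m M^T *m altpow M k.
Proof. by rewrite /altpow_succ castmx_id. Qed.

(** The entry is the sum of the squares of row [i], which vanishes only if each square does. *)
Lemma gram_diag_gt0 {r s} (M : 'M[nat]_(r, s)) i :
  row i M != 0 -> (0 < (M *m M^T) i i)%N.
Proof.
move=> /eqP row_neq0; rewrite lt0n; apply/eqP; rewrite mxE => /eqP.
rewrite sum_nat_eq0 => /forallP sq0; apply: row_neq0; apply/rowP=> j.
by have := sq0 j; rewrite !mxE /= muln_eq0 orbb => /eqP.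
Qed.

(** The summand [A i i * B i j] of the product alone dominates [B i j]. *)
Lemma leq_mulmx_diag {m p} (A : 'M[nat]_m) (B : 'M[nat]_(m, p)) i j :
  (0 < A i i)%N -> (B i j <= (A *m B) i j)%N.
Proof.
move=> Aii_gt0; rewrite mxE (bigD1 i) //=.
by apply: leq_trans (leq_addr _ _); rewrite leq_pmull.
Qed.

Lemma leq_scale_zeros {m p} (A B : 'M[nat]_(m, p)) :
  (exists2 q : nat, (0 < q)%N & forall i j, (B i j <= (q *: A) i j)%N) <->
  zeros A \subset zeros B.
Proof.
split=> [[q _ leBqA]|/subsetP subZ].
  apply/subsetP=> -[i j]; rewrite !inE /= => /eqP Aij0.
  by have := leBqA i j; rewrite mxE Aij0 mulr0 leqn0.
(* The successor keeps [q] positive even when [B] is zero. *)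
exists (\max_(ij : 'I_m * 'I_p) B ij.1 ij.2).+1 => // i j; rewrite mxE.
have [Aij0|Aij_gt0] := posnP (A i j).
  have := subZ (i, j); rewrite !inE /= Aij0 => /(_ isT) /eqP ->.
  exact: leq0n.
apply: leq_trans (leq_pmulr _ Aij_gt0); apply: leqW.
exact: (leq_bigmax (F := fun ij : 'I_m * 'I_p => B ij.1 ij.2) (i, j)).
Qed.

Theorem proposition2p2 (r s : nat) (M : 'M[nat]_(r, s)) (n : nat)
    (n_ge2 : (2 <= n)%N) (M_irr : irredundant M) :
  depth_inequality M (ltnW n_ge2) <->
  zeros (altpow M n.-1) = zeros (altpow_succ M (ltnW n_ge2)).
Proof.
apply: (iff_trans (leq_scale_zeros _ _)).
have subZ : zeros (altpow_succ M (ltnW n_ge2)) \subset zeros (altpow M n.-1).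
  case: n n_ge2 => [|[|k]] // k_ge2; rewrite altpow_succE.
  apply/subsetP=> -[i j]; rewrite !inE /= => /eqP MMMij0.
  have := leq_mulmx_diag (M *m M^T) (altpow M k.+1) i j.
  by rewrite MMMij0 leqn0; apply; apply/gram_diag_gt0/M_irr.1.
split=> [subZ'|-> //]; apply/eqP.
by rewrite eqEsubset subZ' subZ.
Qed.
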